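(* In the setting of the context (the convex problem $\min_{u\in V}E(u)$, $E=F+G$, and the additive Schwarz method with backtracking), suppose that the stable decomposition, strengthened convexity and local stability assumptions hold (with constants $q>1$, $C_{0,K}$, $\tau_0$, $\omega_0$). Let $\{u^{(n)}\}$, $\{\tau^{(n)}\}$ be generated by the additive Schwarz method with backtracking, with parameters $\omega\ge\omega_0$ and $\rho\in(0,1)$. If $$\zeta_0 := E(u^{(0)})-E(u^* ) \le \omega\, C_{0,K_0}^q R_0^q,$$ then for every $n\ge 1$ $$E(u^{(n)})-E(u^* ) \le \frac{q^{q-1}R_0^q\,\bar\kappa_\nu}{\left(n+q\left(R_0^q\bar\kappa_\nu/\zeta_0\right)^{-\nu}\right)^{q-1}},$$ where $\nu=-\frac{1}{q-1}$ and $$\bar\kappa_\nu=\left(\frac1n\sum_{j=1}^n\kappa_{\tau^{(j)},\omega}^{\nu}\right)^{1/\nu},\qquad \kappa_{\tau,\omega}=\frac{\omega\,C_{0,K_\tau}^q}{\tau^{q-1}}.$$ (If $\zeta_0=0$, the right-hand side is read as $0$.)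
   Context: **Problem.** $V$ is a reflexive Banach space with norm $\|\cdot\|$, $F:V\to\mathbb R$ is convex and Fréchet differentiable, $G:V\to\overline{\mathbb R}=\mathbb R\cup\{+\infty\}$ is proper, convex and lower semicontinuous, $E=F+G$ is coercive, and $u^*\in V$ is a minimizer of $E$. $\operatorname{dom}G=\{v: G(v)<\infty\}$. The Bregman distance is $D_F(u,v)=F(u)-F(v)-\langle F'(v),u-v\rangle$. **Space decomposition.** For $1\le k\le N$, $V_k$ is a reflexive Banach space and $R_k^*:V_k\to V$ is a bounded linear operator whose adjoint $R_k:V^*\to V_k^*$ is surjective, with $V=\sum_{k=1}^N R_k^*V_k$. The functionals $d_k,G_k:V_k\times V\to\overline{\mathbb R}$ are proper, convex and lower semicontinuous in their first arguments. **Assumption (stable decomposition).** There is $q>1$ such that for every bounded convex $K\subseteq V$ there is a constant $C_{0,K}>0$ such that for any $u,v\in K\cap\operatorname{dom}G$ there exist $w_k\in V_k$, $1\le k\le N$, with $u-v=\sum_k R_k^*w_k$, $$\sum_{k=1}^N d_k(w_k,v)\le\frac{C_{0,K}^q}{q}\|u-v\|^q,\qquad \sum_{k=1}^N G_k(w_k,v)\le G(u)+(N-1)G(v).$$ The constants are chosen monotone: $C_{0,K}\le C_{0,K'}$ if $K\subseteq K'$. **Assumption (strengthened convexity).** There is $\tau_0\in(0,1]$ such that for any $v\in V$, $w_k\in V_k$ ($1\le k\le N$) and $\tau\in(0,\tau_0]$, $$(1-\tau N)E(v)+\tau\sum_{k=1}^N E(v+R_k^*w_k)\ge E\Big(v+\tau\sum_{k=1}^N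 R_k^*w_k\Big)$$ (required whenever the left-hand side is well defined in $(-\infty,+\infty]$). **Assumption (local stability).** There is $\omega_0>0$ such that for any $v\in\operatorname{dom}G$ and $w_k\in V_k$, $1\le k\le N$: $D_F(v+R_k^*w_k,v)\le\omega_0 d_k(w_k,v)$ and $G(v+R_k^*w_k)\le G_k(w_k,v)$. **Additive Schwarz method with backtracking.** Choose $u^{(0)}\in\operatorname{dom}G$, $\tau^{(0)}=\tau_0$, $\omega\ge\omega_0$, $\rho\in(0,1)$. For $n=0,1,2,\dots$: choose, for $1\le k\le N$, $$w_k^{(n+1)}\in\arg\min_{w_k\in V_k}\{F(u^{(n)})+\langle F'(u^{(n)}),R_k^*w_k\rangle+\omega d_k(w_k,u^{(n)})+G_k(w_k,u^{(n)})\}$$ (such minimizers, with finite minimum value, are assumed to exist). Start with $\tau=\tau^{(n)}/\rho$; as long as the criterion $$E\Big(u^{(n)}+\tau\sum_k R_k^*w_k^{(n+1)}\Big)\le(1-\tau N)E(u^{(n)})+\tau\sum_{k=1}^N E(u^{(n)}+R_k^*w_k^{(n+1)})$$ fails, replace $\tau$ by $\rho\tau$. When it holds, set $\tau^{(n+1)}=\tau$ and $u^{(n+1)}=u^{(n)}+\tau^{(n+1)}\sum_k R_k^*w_k^{(n+1)}$. **Notation.** $K_0=\{u\in V:E(u)\le E(u^{(0)})\}$, which is bounded and convex; $R_0>0$ is a constant with $K_0\subseteq\{u:\|u-u^*\|\le R_0\}$; for $\tau>0$, $K_\tau=\{\frac1\tau u-(\frac1\tau-1)v:u,v\in K_0\}$.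 *)

(* Defs.v *)
From HB Require Import structures.
From mathcomp Require Import all_boot all_order all_algebra.
From mathcomp Require Import all_classical all_reals all_analysis.

Set Implicit Arguments.
Unset Strict Implicit.
Unset Printing Implicit Defensive.

Import Order.TTheory GRing.Theory Num.Theory.
Import numFieldNormedType.Exports.

Local Open Scope classical_set_scope.
Local Open Scope ring_scope.

Section dual_space.
Context {R : realType} (V : normedModType R).

Definition dual_pred : {pred (V -> R^o)} :=
  mem [set f : V -> R^o | linear f /\ continuous f].

Record dual := Dual { dual_fun :> V -> R^o ; _ : dual_fun \in dual_pred }.

HB.instance Definition _ := [isSub for dual_fun].
HB.instance Definition _ := [Choice of dual by <:].

Fact dual_submod_closed : submod_closed dual_pred.
Proof.
split=> [|a f g]; rewrite !inE /=.
  by split=> [b x y|x]; [rewrite scaler0 addr0|exact: cvg_cst].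
move=> [lf cf] [lg cg]; split=> [b x y|x].
  by rewrite !fctE lf lg !scalerDr !scalerA mulrC addrACA.
by apply: continuousD; [apply: continuousZl_tmp; exact: cf|exact: cg].
Qed.

HB.instance Definition _ :=
  GRing.isSubmodClosed.Build R (V -> R^o) dual_pred dual_submod_closed.
HB.instance Definition _ := [SubChoice_isSubLmodule of dual by <:].

Lemma dual_linear (f : dual) : linear f.
Proof. by case: f => f fP; have [] := set_mem fP. Qed.

Lemma dual_continuous (f : dual) : continuous f.
Proof. by case: f => f fP; have [] := set_mem fP. Qed.

Definition dual_norm (f : dual) : R :=
  sup [set `|f x| | x in [set x : V | `|x| <= 1]].

Lemma dual0 (f : dual) : f 0 = 0.
Proof. by have := dual_linear f 1 0 0; rewrite !scale1r addr0 => /eqP;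
  rewrite -subr_eq0 opprD addrA subrr sub0r oppr_eq0 => /eqP. Qed.

Lemma dualZ (f : dual) a x : f (a *: x) = a *: f x.
Proof. by rewrite -[a *: x]addr0 dual_linear dual0 addr0. Qed.

Lemma dual_has_sup (f : dual) :
  has_sup [set `|f x| | x in [set x : V | `|x| <= 1]].
Proof.
split; first by exists `|f 0|, 0 => //=; rewrite normr0 ler01.
pose g : {linear V -> R^o} :=
  HB.pack (f : V -> R^o) (GRing.isLinear.Build _ _ _ _ _ (dual_linear f)).
have /bounded_funP /(_ 1) [M fM] : bounded_near g (nbhs (0 : V)).
  by apply: continuous_linear_bounded; exact: dual_continuous.
by exists M => _ [x x1 <-]; exact: fM.
Qed.

Lemma dual_norm_ub (f : dual) x : `|x| <= 1 -> `|f x| <= dual_norm f.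
Proof.
by move=> x1; apply: (sup_upper_bound (dual_has_sup f)); exists x.
Qed.

Lemma dual_norm_le (f : dual) M :
  (forall x, `|x| <= 1 -> `|f x| <= M) -> dual_norm f <= M.
Proof.
move=> fM; apply: ge_sup; first by case: (dual_has_sup f).
by move=> _ [x x1 <-]; exact: fM.
Qed.

Lemma dual_normD (f g : dual) : dual_norm (f + g) <= dual_norm f + dual_norm g.
Proof.
apply: dual_norm_le => x x1; apply: (le_trans (ler_normD _ _)).
by apply: lerD; exact: dual_norm_ub.
Qed.

Lemma dual_normZ (a : R) (f : dual) : dual_norm (a *: f) = `|a| * dual_norm f.
Proof.
have leZ b h : dual_norm (b *: h) <= `|b| * dual_norm h.
  apply: dual_norm_le => x x1.
  rewrite [X in X <= _](_ : _ = `|b| * `|h x|); last exact: normrM.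
  by apply: ler_wpM2l => //; exact: dual_norm_ub.
apply/eqP; rewrite eq_le leZ /=.
have [->|a0] := eqVneq a 0.
  rewrite normr0 mul0r; apply: (le_trans (normr_ge0 _)).
  by apply: (@dual_norm_ub _ 0); rewrite normr0 ler01.
rewrite -ler_pdivlMl ?normr_gt0// -normfV.
by have := leZ a^-1 (a *: f); rewrite scalerA mulVf// scale1r.
Qed.

Lemma dual_norm0_eq0 (f : dual) : dual_norm f = 0 -> f = 0.
Proof.
move=> f0; apply: val_inj; apply/funext => x /=.
have [->|x0] := eqVneq x 0; first exact: dual0.
have nx0 : `|x| != 0 by rewrite normr_eq0.
have : `|f (`|x|^-1 *: x)| <= dual_norm f.
  by apply: dual_norm_ub; rewrite normrZ normfV normr_id mulVf.
rewrite f0 normr_le0 dualZ scaler_eq0 invr_eq0 (negbTE nx0) /=.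
by move=> /eqP.
Qed.

HB.instance Definition _ := @Lmodule_isNormed.Build R dual dual_norm
  dual_normD dual_normZ dual_norm0_eq0.

End dual_space.

Definition reflexive_space {R : realType} (V : normedModType R) :=
  forall Phi : dual (dual V), exists x : V, forall f : dual V, Phi f = f x.

Section adjoint_operator.
Context {R : realType} {W V : normedModType R}.
Variables (T : {linear W -> V}) (cT : continuous T).

Fact adjoint_subproof (phi : dual V) :
  (phi \o T : W -> R^o) \in @dual_pred R W.
Proof.
rewrite inE; split=> [a x y|x] /=; first by rewrite linearP dual_linear.
by apply: continuous_comp; [exact: cT|exact: dual_continuous].
Qed.

Definition adjoint (phi : dual V) : dual W := Dual (adjoint_subproof phi).

End adjoint_operator.

Section convex_analysis.
Context {R : realType} {V : normedModType R}.

Definition effective_domain (f : V -> \bar R) : set V :=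
  [set v | (f v < +oo)%E].

Definition proper_efunction (f : V -> \bar R) :=
  (forall v, (-oo < f v)%E) /\ effective_domain f !=set0.

(* The library convention 0 * +oo = 0 makes the cases t = 0 and t = 1 harmless
   for functions that do not take the value -oo. *)
Definition convex_efunction (f : V -> \bar R) := forall (t : R) u v,
  0 <= t <= 1 ->
  (f (t *: u + (1 - t) *: v)%R <= t%:E * f u + (1 - t)%:E * f v)%E.

Definition coercive (f : V -> \bar R) :=
  forall M : R, exists r : R, forall v, r < `|v| -> (M%:E < f v)%E.

(* 'd F v is the Frechet derivative, so 'd F v h is the duality pairing
   <F'(v), h>. *)
Definition bregman (F : V -> R^o) (u v : V) : R := F u - F v - 'd F v (u - v).

Definition energy (F : V -> R^o) (G : V -> \bar R) (v : V) : \bar R :=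
  ((F v)%:E + G v)%E.

Definition K_sub (E : V -> \bar R) (u0 : V) : set V :=
  [set u | (E u <= E u0)%E].

Definition K_ext (K0 : set V) (tau : R) : set V :=
  [set x | exists u v, [/\ K0 u, K0 v & x = tau^-1 *: u - (tau^-1 - 1) *: v]].

End convex_analysis.

Section additive_schwarz.
Context {R : realType} {V : normedModType R} {N : nat}.
Context {Vk : 'I_N -> normedModType R}.
(* Rs k stands for R_k^* : V_k -> V; the restriction R_k : V^* -> V_k^* is its
   adjoint. *)
Variable Rs : forall k, {linear Vk k -> V}.

Definition space_decomposition :=
  forall v : V, exists w : forall k, Vk k, v = \sum_k Rs k (w k).

(* C0 K is the constant of the bounded convex set K; its values on other sets
   are irrelevant. *)
Definition stable_decomposition (G : V -> \bar R)
    (d Gk : forall k, Vk k -> V -> \bar R) (q : R) (C0 : set V -> R) :=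
  (forall K : set V, bounded_set K -> convex_set K ->
    0 < C0 K /\
    forall u v : V, (K `&` effective_domain G) u ->
      (K `&` effective_domain G) v ->
    exists w : forall k, Vk k,
      [/\ u - v = \sum_k Rs k (w k),
          (\sum_k d k (w k) v <= (C0 K `^ q / q * `|u - v| `^ q)%:E)%E &
          (\sum_k Gk k (w k) v <= G u + (N%:R - 1)%:E * G v)%E]) /\
  (forall K K' : set V,
    bounded_set K -> convex_set K -> bounded_set K' -> convex_set K' ->
    K `<=` K' -> C0 K <= C0 K').

(* The inequality is required when its left-hand side is well defined (neither
   0 * +oo nor -oo + +oo occurs in it) and different from -oo. *)
Definition strengthened_convexity (E : V -> \bar R) (tau0 : R) :=
  forall (v : V) (w : forall k, Vk k) (tau : R), 0 < tau <= tau0 ->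
  let a := (1 - tau * N%:R)%:E in
  let b := (tau%:E * \sum_k E (v + Rs k (w k))%R)%E in
  (a *? E v)%E -> (a * E v +? b)%E -> (-oo < a * E v + b)%E ->
  (E (v + tau *: \sum_k Rs k (w k))%R <= a * E v + b)%E.

Definition local_stability (F : V -> R^o) (G : V -> \bar R)
    (d Gk : forall k, Vk k -> V -> \bar R) (omega0 : R) :=
  forall v, effective_domain G v -> forall k (wk : Vk k),
    ((bregman F (v + Rs k wk) v)%:E <= omega0%:E * d k wk v)%E /\
    (G (v + Rs k wk)%R <= Gk k wk v)%E.

Definition local_energy (F : V -> R^o) (d Gk : forall k, Vk k -> V -> \bar R)
    (omega : R) (u : V) k (wk : Vk k) : \bar R :=
  ((F u + 'd F u (Rs k wk))%:E + omega%:E * d k wk u + Gk k wk u)%E.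

Definition is_finite_argmin {T : Type} (f : T -> \bar R) (x : T) :=
  f x \is a fin_num /\ forall y, (f x <= f y)%E.

Definition backtracking_criterion (E : V -> \bar R) (u : V)
    (w : forall k, Vk k) (tau : R) :=
  (E (u + tau *: \sum_k Rs k (w k))%R <=
   (1 - tau * N%:R)%:E * E u + tau%:E * \sum_k E (u + Rs k (w k))%R)%E.

(* The n-th backtracking loop tries the step sizes tau n / rho * rho ^+ m for
   m = 0, 1, ... and stops at the first one that meets the criterion. *)
Definition schwarz_backtracking (F : V -> R^o) (G : V -> \bar R)
    (d Gk : forall k, Vk k -> V -> \bar R) (tau0 omega rho : R)
    (u : nat -> V) (tau : nat -> R) (w : nat -> forall k, Vk k) :=
  [/\ effective_domain G (u 0%N), tau 0%N = tau0 &
  forall n : nat,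
    [/\ forall k,
          is_finite_argmin (local_energy F d Gk omega (u n) (k := k)) (w n.+1 k),
        exists m : nat,
          [/\ tau n.+1 = tau n / rho * rho ^+ m,
              backtracking_criterion (energy F G) (u n) (w n.+1) (tau n.+1) &
              forall j : nat, (j < m)%N ->
                ~ backtracking_criterion (energy F G) (u n) (w n.+1)
                    (tau n / rho * rho ^+ j)] &
        u n.+1 = u n + tau n.+1 *: \sum_k Rs k (w n.+1 k)]].

End additive_schwarz.

Section convergence_rate.
Context {R : realType} {V : normedModType R}.

Definition kappa (omega q : R) (C0 : set V -> R) (K0 : set V) (tau : R) : R :=
  omega * C0 (K_ext K0 tau) `^ q / tau `^ (q - 1).

Definition power_mean (nu : R) (x : nat -> R) (n : nat) : R :=
  (n%:R^-1 * \sum_(1 <= j < n.+1) x j `^ nu) `^ nu^-1.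

End convergence_rate.

(* Main.v *)
Require Import Defs.
From mathcomp Require Import all_boot all_order all_algebra.
From mathcomp Require Import all_classical all_reals all_analysis.
From mathcomp Require Import ring.

(** The segment from [u n] to [ustar] lies in [K0], so the stable decomposition
    can be applied to the pair [t *: ustar + (1 - t) *: u n], [u n] with the
    constant of [K0].  Together with the backtracking criterion, local stability
    and the minimality of the [w n.+1 k], it bounds the energy gap [z] by
      [z n.+1 <= z n - tau n.+1 * (t * z n - M / q * t `^ q)],
    where [M = omega * C0 K0 `^ q * R0 `^ q].  The best [t] is
    [(z n / M) `^ a] with [a = (q - 1)^-1], admissible because [zeta0 <= M].
    As [K0] is contained in every [K_tau], this gives
      [z n.+1 <= z n * (1 - (1 - q^-1) * (z n / L) `^ a)]
    with [L = kappa * R0 `^ q], and Bernoulli's inequality for the exponent [- a]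
    turns it into the additive recursion
    [z n.+1 `^ (- a) >= z n `^ (- a) + q^-1 * L `^ (- a)], which is summed. *)

Set Implicit Arguments.
Unset Strict Implicit.
Unset Printing Implicit Defensive.

Import Order.TTheory GRing.Theory Num.Theory.
Import numFieldNormedType.Exports.

Local Open Scope classical_set_scope.
Local Open Scope ring_scope.

(** * Real powers: from a one-step decrease to a decay rate *)

Lemma bernoulli_powRN (R : realType) (a s : R) : 0 <= a -> s < 1 ->
  1 + a * s <= (1 - s) `^ (- a).
Proof.
move=> a0 s1; have s1' : 0 < 1 - s by rewrite subr_gt0.
(* The power is [expR (- a * ln (1 - s))]: use [1 + x <= expR x], then [ln (1 - s) <= - s]. *)
rewrite /powR gt_eqF//; apply: le_trans (expR_ge1Dx _).
rewrite lerD2l mulNr -mulrN ler_wpM2l// lerNr.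
by apply: le_ln1Dx; rewrite ltrN2.
Qed.

Lemma powRN_ler (R : realType) (a x y : R) : 0 <= a -> 0 < x -> x <= y ->
  y `^ (- a) <= x `^ (- a).
Proof.
move=> a0 x0 xy; have y0 := lt_le_trans x0 xy.
rewrite !powRN lef_pV2 ?posrE ?powR_gt0//.
by apply: ge0_ler_powR => //; rewrite nnegrE ltW.
Qed.

(** The increment is free of [x]: in the Bernoulli term the powers of [x] cancel, and
    [(q - 1)^-1 * (1 - q^-1) = q^-1]. *)
Lemma powR_decrease (R : realType) (q L x y : R) : 1 < q -> 0 < L ->
  0 < x -> 0 < y ->
  y <= x * (1 - (1 - q^-1) * (x / L) `^ (q - 1)^-1) ->
  x `^ (- (q - 1)^-1) + q^-1 * L `^ (- (q - 1)^-1) <= y `^ (- (q - 1)^-1).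
Proof.
move=> q1 L0 x0 y0; set a := (q - 1)^-1; set s := (1 - q^-1) * _ => yx.
have q0 : 0 < q - 1 by rewrite subr_gt0.
have a0 : 0 < a by rewrite invr_gt0.
(* Positivity of [y] forces [1 - s > 0]. *)
have s1 : s < 1.
  by rewrite -subr_gt0 -(pmulr_rgt0 _ x0); exact: lt_le_trans yx.
apply: le_trans (powRN_ler (ltW a0) y0 yx).
rewrite powRM ?(ltW x0)//; last by rewrite subr_ge0 ltW.
apply: le_trans (ler_wpM2l (powR_ge0 _ _) (bernoulli_powRN (ltW a0) s1)).
rewrite mulrDr mulr1 lerD2l /s powRM ?(ltW x0) ?invr_ge0 ?(ltW L0)//.
have -> : L^-1 `^ a = L `^ (- a) by rewrite -powR_inv1 ?ltW// -powRrM mulN1r.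
rewrite [x `^ (- a)]powRN le_eqVlt; apply/orP; left; apply/eqP.
have xa : x `^ a != 0 by rewrite gt_eqF// powR_gt0.
have qq : q != 0 by rewrite gt_eqF// (lt_trans ltr01).
have qq1 : q - 1 != 0 by rewrite gt_eqF.
move: xa; move: (x `^ a) => X xa.
by rewrite /a; field; rewrite qq qq1 xa.
Qed.

Lemma powR_decrease_sum (R : realType) (q : R) (L z : nat -> R) (n : nat) :
  1 < q -> (forall i, 0 < L i) -> (forall i, (i <= n)%N -> 0 < z i) ->
  (forall i, z i.+1 <= z i * (1 - (1 - q^-1) * (z i / L i.+1) `^ (q - 1)^-1)) ->
  z 0%N `^ (- (q - 1)^-1) + q^-1 * \sum_(1 <= j < n.+1) L j `^ (- (q - 1)^-1)
    <= z n `^ (- (q - 1)^-1).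
Proof.
move=> q1 L0 + zL; elim: n => [|n IH] z0.
  by rewrite big_geq// mulr0 addr0.
rewrite big_nat_recr//= mulrDr addrA.
apply: le_trans
  (powR_decrease q1 (L0 n.+1) (z0 n (leqnSn n)) (z0 n.+1 (leqnn _)) (zL n)).
by rewrite lerD2r; apply: IH => i ni; apply: z0; exact: leqW.
Qed.

(** Solves the summed recursion for [y]: the power [- (q - 1)] inverts the power [- a], and the
    left-hand side factors through the base [c] of the denominator. *)
Lemma powR_rate (R : realType) (q B x y : R) (n : nat) : 1 < q -> 0 < B ->
  0 < x -> 0 < y ->
  x `^ (- (q - 1)^-1) + q^-1 * (n%:R * B `^ (- (q - 1)^-1))
    <= y `^ (- (q - 1)^-1) ->
  y <= q `^ (q - 1) * B / (n%:R + q * (B / x) `^ (q - 1)^-1) `^ (q - 1).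
Proof.
move=> q1 B0 x0 y0; set a := (q - 1)^-1 => xy.
have q0 : 0 < q by exact: lt_trans q1.
have p0 : 0 < q - 1 by rewrite subr_gt0.
have aK (z : R) : 0 < z -> (z `^ (- a)) `^ (- (q - 1)) = z.
  by move=> z0; rewrite -powRrM mulrNN mulVf ?gt_eqF// powRr1// ltW.
set c := n%:R + q * (B / x) `^ a.
have c0 : 0 <= c.
  by rewrite addr_ge0// mulr_ge0 ?(ltW q0)// powR_ge0.
have sE : x `^ (- a) + q^-1 * (n%:R * B `^ (- a)) =
    q^-1 * (B `^ (- a) * c).
  rewrite /c powRM ?invr_ge0 ?ltW//.
  have -> : x^-1 `^ a = x `^ (- a) by rewrite -powR_inv1 ?ltW// -powRrM mulN1r.
  rewrite [B `^ (- a)]powRN.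
  have : B `^ a != 0 by rewrite gt_eqF// powR_gt0.
  by move: (B `^ a) => X X1; field; rewrite X1 gt_eqF.
have s0 : 0 < x `^ (- a) + q^-1 * (n%:R * B `^ (- a)).
  by rewrite ltr_pwDl ?powR_gt0// mulr_ge0 ?invr_ge0 ?(ltW q0)// mulr_ge0 ?powR_ge0.
rewrite -[y in y <= _]aK//; apply: le_trans (powRN_ler (ltW p0) s0 xy) _.
rewrite sE powRM ?invr_ge0 ?(ltW q0) ?mulr_ge0 ?powR_ge0//.
rewrite powRM ?powR_ge0//.
rewrite aK// mulrA -[q^-1]powR_inv1 ?(ltW q0)// -powRrM mulN1r opprK.
by rewrite (powRN c).
Qed.

(** * Convexity of the energy, of its sublevel sets and of their extensions *)

Section convexity.
Context {R : realType} {V : normedModType R}.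
Implicit Types (F : V -> R^o) (G : V -> \bar R).

Lemma convex_function_le F (t : R) x y : convex_function [set: V] F ->
  0 <= t <= 1 -> F (t *: x + (1 - t) *: y) <= t * F x + (1 - t) * F y.
Proof.
by move=> cF /andP[t0 t1]; exact: (cF (Itv01 t0 t1) x y (in_setT _) (in_setT _)).
Qed.

(** By convexity the difference quotient along [x - v] is at most [F x - F v] for steps in (0, 1];
    let the step tend to 0 from the right. *)
Lemma convex_gradient_le F v x : convex_function [set: V] F ->
  differentiable F v -> 'd F v (x - v) <= F x - F v.
Proof.
move=> cF dF; rewrite -deriveE//.
have lP : (fun h : R => h^-1 *: (F (h *: (x - v) + v) - F v)) @ 0^' -->
    ('D_(x - v) F v : R^o) by exact: diff_derivable.
apply: (cvgr_to_le (cvg_dnbhs_at_right lP)).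
near=> t.
have t0 : 0 < t by near: t; exact: nbhs_right_gt.
have t1 : t <= 1 by near: t; exact: nbhs_right_le.
rewrite ler_pdivrMl// lerBlDr.
have -> : t *: (x - v) + v = t *: x + (1 - t) *: v.
  by rewrite scalerBr scalerBl scale1r addrA addrAC.
apply: le_trans (convex_function_le _ _ cF _) _; first by rewrite ltW.
by rewrite le_eqVlt; apply/orP; left; apply/eqP; ring.
Unshelve. all: by end_near. Qed.

Lemma bregman_ge0 F x v : convex_function [set: V] F ->
  differentiable F v -> 0 <= bregman F x v.
Proof. by move=> cF dF; rewrite subr_ge0; exact: convex_gradient_le. Qed.

Lemma energy_convex F G (t : R) x y : convex_function [set: V] F ->
  convex_efunction G -> 0 <= t <= 1 ->
  (forall v, (-oo < G v)%E) ->
  (energy F G (t *: x + (1 - t) *: y)%R <=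
   t%:E * energy F G x + (1 - t)%:E * energy F G y)%E.
Proof.
move=> cF cG t01 Gy.
rewrite /energy !muleDr// addeACA; apply: leeD.
  by rewrite -!EFinM -EFinD lee_fin; exact: convex_function_le.
exact: cG.
Qed.

Lemma K_sub_convex F G u0 : convex_function [set: V] F ->
  convex_efunction G -> (forall v, (-oo < G v)%E) ->
  convex_set (K_sub (energy F G) u0).
Proof.
move=> cF cG Gy x y l; rewrite !inE /K_sub /= => xK yK.
have l01 : 0 <= l%:num <= 1 by apply/andP.
apply: le_trans (energy_convex x y cF cG l01 Gy) _.
case/andP: l01 => l0 l1.
apply: le_trans (leeD (lee_wpmul2l _ xK) (lee_wpmul2l _ yK)) _;
  rewrite ?lee_fin ?subr_ge0//.
rewrite -ge0_muleDl ?lee_fin ?subr_ge0//.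
by rewrite -EFinD subrKC mul1e.
Qed.

(** [K_ext K t] is a linear image of the product of [K] with itself, so the witnesses are combined
    separately. *)
Lemma K_ext_convex (K : set V) (t : R) : convex_set K -> convex_set (K_ext K t).
Proof.
move=> cK x y l; rewrite !inE => -[a [b [aK bK ->]]] [a' [b' [aK' bK' ->]]].
exists (conv l (a : convex_lmodType V) a'), (conv l (b : convex_lmodType V) b').
split.
- by rewrite -inE; apply: cK; rewrite inE.
- by rewrite -inE; apply: cK; rewrite inE.
rewrite /conv/=.
rewrite !scalerDr !scalerN !scalerA opprD addrACA.
by congr (_ + _ + (_ + _)); rewrite // -?scalerN // mulrC.
Qed.

Lemma bounded_setP (K : set V) :
  bounded_set K <-> exists M : R, forall x, K x -> `|x| <= M.
Proof.
split=> [/pinfty_ex_gt0[M _ KM]|[M KM]]; first by exists M => x; exact: KM.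
exists M; split; first exact: num_real.
by move=> M' MM' x /KM /le_trans; apply; exact: ltW.
Qed.

Lemma K_ext_bounded (K : set V) (t : R) :
  bounded_set K -> bounded_set (K_ext K t).
Proof.
move=> /bounded_setP[M KM]; apply/bounded_setP.
exists (`|t^-1| * M + `|t^-1 - 1| * M) => _ [a [b [/KM aM /KM bM ->]]].
by apply: le_trans (ler_normB _ _) _; rewrite !normrZ lerD// ler_wpM2l.
Qed.

Lemma sub_K_ext (K : set V) (t : R) : K `<=` K_ext K t.
Proof.
by move=> x Kx; exists x, x; split; rewrite // -scalerBl subKr scale1r.
Qed.

End convexity.

(** * Energy estimate for one Schwarz step *)

Section schwarz_step.
Context {R : realType} {V : normedModType R} {N : nat}.
Context {Vk : 'I_N -> normedModType R}.
Context (Rs : forall k, {linear Vk k -> V}).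
Context (F : V -> R^o) (G : V -> \bar R) (d Gk : forall k, Vk k -> V -> \bar R).
Context (omega0 omega : R).
Context (cF : convex_function [set: V] F)
  (dF : forall v, differentiable F v)
  (omega0_gt0 : 0 < omega0) (omega0_le : omega0 <= omega)
  (hlocal : local_stability Rs F G d Gk omega0).

(** This sign allows [omega0] to be raised to [omega], and [omega] to be distributed over an
    extended-real sum. *)
Lemma local_stability_d_ge0 v k (wk : Vk k) : effective_domain G v ->
  (0 <= d wk v)%E.
Proof.
move=> vG; have [h _] := hlocal vG wk.
have : (0 <= omega0%:E * d wk v)%E.
  by apply: le_trans h; rewrite lee_fin; exact: bregman_ge0.
by rewrite pmule_rge0// lte_fin.
Qed.

(** The Bregman distance is exactly the linearization error of [F], which local stability controls
    by [d]. *)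
Lemma energy_le_local_energy v k (wk : Vk k) : effective_domain G v ->
  (energy F G (v + Rs k wk)%R <= local_energy Rs F d Gk omega v wk)%E.
Proof.
move=> vG; have [h1 h2] := hlocal vG wk.
rewrite /energy /local_energy; apply: leeD => //.
have -> : F (v + Rs k wk) = F v + 'd F v (Rs k wk) + bregman F (v + Rs k wk) v.
  by rewrite /bregman [v + _]addrC addrK; ring.
rewrite EFinD leeD2l//; apply: le_trans h1 _.
by apply: lee_wpmul2r; rewrite ?lee_fin//; exact: local_stability_d_ge0.
Qed.

Lemma sum_local_energyE v (w : forall k, Vk k) : effective_domain G v ->
  (\sum_k local_energy Rs F d Gk omega v (w k) =
   (N%:R * F v + 'd F v (\sum_k Rs k (w k)))%:E +
   omega%:E * \sum_k d (w k) v + \sum_k Gk (w k) v)%E.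
Proof.
move=> vG; rewrite /local_energy !big_split/=; congr (_ + _ + _)%E.
  rewrite sumEFin big_split/= linear_sum; congr (_ + _)%:E.
  by rewrite sumr_const card_ord mulr_natl.
by rewrite ge0_sume_distrr// => k _; exact: local_stability_d_ge0.
Qed.

Lemma schwarz_step (q : R) (C0 : set V -> R) (K : set V) v x
    (w : forall k, Vk k) (tau : R) :
  (forall y, (-oo < G y)%E) ->
  stable_decomposition Rs G d Gk q C0 -> bounded_set K -> convex_set K ->
  K v -> K x -> effective_domain G v -> effective_domain G x -> 0 < tau ->
  (forall k, is_finite_argmin (local_energy Rs F d Gk omega v (k := k)) (w k)) ->
  backtracking_criterion Rs (energy F G) v w tau ->
  (energy F G (v + tau *: \sum_k Rs k (w k))%R <=
   (1 - tau)%:E * energy F G v + tau%:E *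
     (energy F G x + (omega * (C0 K `^ q / q * `|x - v| `^ q))%:E))%E.
Proof.
move=> Gy hstable bK cvK Kv Kx vG xG tau0 wmin crit.
have [_ /(_ x v (conj Kx xG) (conj Kv vG))[w' [xv hd hG]]] := hstable.1 K bK cvK.
set D := C0 K `^ q / q * `|x - v| `^ q in hd *.
have /fineK Gv : G v \is a fin_num by rewrite fin_numElt Gy vG.
have /fineK Gx : G x \is a fin_num by rewrite fin_numElt Gy xG.
set gv := fine (G v) in Gv; set gx := fine (G x) in Gx.
have omega_ge0 : 0 <= omega by apply: le_trans omega0_le; exact: ltW.
pose S := N%:R * F v + 'd F v (x - v) + omega * D + (gx + (N%:R - 1) * gv).
(* Minimality replaces [w] by the stable decomposition [w'] of [x - v], whose linear terms add up to
   ['d F v (x - v)]. *)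
have sumS : (\sum_k energy F G (v + Rs k (w k))%R <= S%:E)%E.
  apply: (@le_trans _ _ (\sum_k local_energy Rs F d Gk omega v (w' k))%E).
    apply: lee_sum => k _; apply: le_trans (energy_le_local_energy _ vG) _.
    by have [_] := wmin k; exact.
  rewrite sum_local_energyE// -xv.
  apply: le_trans (leeD (leeD2l _ (lee_wpmul2l _ hd)) hG) _.
    by rewrite lee_fin.
  by rewrite -Gv -Gx -!(EFinD, EFinM).
apply: le_trans crit _.
apply: le_trans (leeD2l _ (lee_wpmul2l _ sumS)) _; first by rewrite lee_fin ltW.
rewrite /energy -Gv -Gx -!(EFinD, EFinM) lee_fin -subr_ge0.
(* All terms in [N] cancel, leaving [tau] times the gap between [F] and its tangent at [v]. *)
have -> : (1 - tau) * (F v + gv) + tau * (F x + gx + omega * D) -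
    ((1 - tau * N%:R) * (F v + gv) + tau * S) =
    tau * (F x - F v - 'd F v (x - v)) by rewrite /S; ring.
by rewrite mulr_ge0 ?(ltW tau0)// subr_ge0 convex_gradient_le.
Qed.

End schwarz_step.

(** [t] is the critical point of the concave function being maximized, where the (q - 1)-th power of
    [t] is [z / M]; [z <= M] makes it admissible. *)
Lemma optimal_step (R : realType) (q M z : R) : 1 < q -> 0 < M -> 0 <= z <= M ->
  let t := (z / M) `^ (q - 1)^-1 in
  0 <= t <= 1 /\ t * z - M / q * t `^ q = (1 - q^-1) * (z * t).
Proof.
move=> q1 M0 /andP[z0 zM] t.
have q0 : 0 < q by exact: lt_trans q1.
have p0 : 0 < q - 1 by rewrite subr_gt0.
have zM0 : 0 <= z / M by rewrite divr_ge0// ltW.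
split.
  rewrite powR_ge0/=; suff : t <= 1 `^ (q - 1)^-1 by rewrite powR1.
  by rewrite ge0_ler_powR ?nnegrE ?invr_ge0 ?(ltW p0)// ler_pdivrMr// mul1r.
have -> : t `^ q = t * (z / M).
  rewrite -mulr_powRB1 ?powR_ge0//; congr (_ * _).
  by rewrite /t -powRrM mulVf ?gt_eqF// powRr1.
by field; rewrite !gt_eqF.
Qed.

Theorem theorem3p9 (R : realType)
  (V : completeNormedModType R) (hV : reflexive_space V)
  (F : V -> R^o) (G : V -> \bar R)
  (hFconv : convex_function [set: V] F)
  (hFdiff : forall v : V, differentiable F v)
  (hGproper : proper_efunction G) (hGconv : convex_efunction G)
  (hGlsc : lower_semicontinuous G)
  (hEcoer : coercive (energy F G))
  (ustar : V) (hustar : forall v : V, (energy F G ustar <= energy F G v)%E)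
  (N : nat) (Vk : 'I_N -> completeNormedModType R)
  (hVk : forall k, reflexive_space (Vk k))
  (Rs : forall k, {linear Vk k -> V}) (hRs : forall k, continuous (Rs k))
  (hRsurj : forall k,
    set_surj [set: dual V] [set: dual (Vk k)] (adjoint (hRs k)))
  (hdecomp : space_decomposition Rs)
  (d Gk : forall k, Vk k -> V -> \bar R)
  (hd : forall k (v : V), [/\ proper_efunction (fun wk : Vk k => d k wk v),
    convex_efunction (fun wk : Vk k => d k wk v) &
    lower_semicontinuous (fun wk : Vk k => d k wk v)])
  (hGk : forall k (v : V), [/\ proper_efunction (fun wk : Vk k => Gk k wk v),
    convex_efunction (fun wk : Vk k => Gk k wk v) &
    lower_semicontinuous (fun wk : Vk k => Gk k wk v)])
  (q : R) (C0 : set V -> R) (hq : 1 < q)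
  (hstable : stable_decomposition Rs G d Gk q C0)
  (tau0 : R) (htau0 : 0 < tau0 <= 1)
  (hsconv : strengthened_convexity Rs (energy F G) tau0)
  (omega0 : R) (homega0 : 0 < omega0)
  (hlocal : local_stability Rs F G d Gk omega0)
  (omega rho : R) (homega : omega0 <= omega) (hrho : 0 < rho < 1)
  (u : nat -> V) (tau : nat -> R) (w : nat -> forall k, Vk k)
  (halg : schwarz_backtracking Rs F G d Gk tau0 omega rho u tau w)
  (R0 : R) (hR0 : 0 < R0)
  (hK0 : forall v : V, K_sub (energy F G) (u 0%N) v -> `|v - ustar| <= R0)
  (zeta0 : R)
  (hzeta0 : (zeta0%:E = energy F G (u 0%N) - energy F G ustar)%E)
  (hzeta0le : zeta0 <= omega * C0 (K_sub (energy F G) (u 0%N)) `^ q * R0 `^ q) :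
  let nu := - (q - 1)^-1 in
  let K0 := K_sub (energy F G) (u 0%N) in
  forall n : nat, (1 <= n)%N ->
  let kbar := power_mean nu (fun j => kappa omega q C0 K0 (tau j)) n in
  let bound := if zeta0 == 0 then 0 else
    q `^ (q - 1) * R0 `^ q * kbar /
      (n%:R + q * (R0 `^ q * kbar / zeta0) `^ (- nu)) `^ (q - 1) in
  (energy F G (u n) - energy F G ustar <= bound%:E)%E.
Proof.
move=> nu K0 n n1; cbv zeta.
set kbar := power_mean _ _ _; set bound := if _ then _ else _.
have [Gy _] := hGproper.
have [u0G tau0E step] := halg.
set E := energy F G in hustar hzeta0 *.
have E_domE y : effective_domain G y <-> (E y < +oo)%E.
  by rewrite /effective_domain /E /energy /=; case: (G y) => [r||]//; rewrite !ltry.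
have Ey y : (-oo < E y)%E.
  by rewrite /E /energy; case: (G y) (Gy y) => // r _; exact: ltNyr.
pose e y := fine (E y).
(* As [u 0] has finite energy, [E] is real-valued on [K0], and the estimates can be made on [e]. *)
have Efin y : K0 y -> E y = (e y)%:E.
  move=> yK; rewrite /e fineK// fin_numElt Ey/=.
  by apply: le_lt_trans yK _; apply/E_domE.
have K0_dom y : K0 y -> effective_domain G y.
  by move=> /Efin yE; apply/E_domE; rewrite yE ltry.
have K0u0 : K0 (u 0%N) by exact: lexx.
have K0us : K0 ustar by exact: hustar.
have K0cv : convex_set K0 by exact: K_sub_convex.
have K0bd : bounded_set K0.
  apply/bounded_setP; exists (R0 + `|ustar|) => y /hK0 yR.
  by rewrite -[y](subrK ustar) (le_trans (ler_normD _ _))// lerD2r.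
have q0 : 0 < q by exact: lt_trans hq.
have p0 : 0 < q - 1 by rewrite subr_gt0.
have om0 : 0 < omega by exact: lt_le_trans homega.
have tau_gt0 i : 0 < tau i.
  elim: i => [|i IH]; first by rewrite tau0E; case/andP: htau0.
  have [_ [m [-> _ _]] _] := step i.
  by case/andP: hrho => r0 _; rewrite mulr_gt0 ?divr_gt0 ?exprn_gt0.
have C0_gt0 : 0 < C0 K0 by have [] := hstable.1 K0 K0bd K0cv.

(* Descent estimate with a free parameter [t], and monotonicity *)
set M := omega * C0 K0 `^ q * R0 `^ q in hzeta0le.
have M0 : 0 < M by rewrite !mulr_gt0 ?powR_gt0.
have desc i t : K0 (u i) -> 0 <= t <= 1 ->
    (E (u i.+1) <= (e (u i) - tau i.+1 *
      (t * (e (u i) - e ustar) - M / q * t `^ q))%:E)%E.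
  move=> uiK t01; have [wmin [m [_ crit _]] ->] := step i.
  pose x := t *: ustar + (1 - t) *: u i.
  have Ex : (E x <= (t * e ustar + (1 - t) * e (u i))%:E)%E.
    apply: le_trans (energy_convex _ _ hFconv hGconv t01 Gy) _.
    by rewrite -/E (Efin _ uiK) (Efin _ K0us) -!EFinM -EFinD.
  have xK : K0 x.
    by have /= := K0cv ustar (u i) (Itv01 (andP t01).1 (andP t01).2);
      rewrite !inE; apply.
  apply: le_trans (schwarz_step hFconv hFdiff homega0 homega hlocal Gy
    hstable K0bd K0cv uiK xK (K0_dom _ uiK) (K0_dom _ xK) (tau_gt0 _) wmin crit) _.
  case/andP: t01 => t0 t1.
  have xu : `|x - u i| `^ q <= t `^ q * R0 `^ q.
    rewrite -powRM ?(ltW hR0)// ge0_ler_powR ?nnegrE ?(ltW q0)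
      ?mulr_ge0 ?(ltW hR0)//.
    have -> : x - u i = t *: (ustar - u i).
      by rewrite /x scalerBl scale1r addrA addrAC addrK scalerBr.
    by rewrite normrZ ger0_norm// ler_wpM2l// distrC; exact: hK0.
  rewrite -/E (Efin _ uiK) (Efin _ xK) -!(EFinD, EFinM) lee_fin -subr_ge0.
  move: Ex; rewrite (Efin _ xK) lee_fin -subr_ge0 => Ex.
  move: xu; rewrite -subr_ge0 => xu.
  have c0 : 0 <= omega * (C0 K0 `^ q / q).
    by rewrite mulr_ge0 ?divr_ge0 ?powR_ge0 ?ltW.
  (* The difference of the two bounds is a nonnegative combination of the convexity slack [Ex] and
     the distance slack [xu]. *)
  have := addr_ge0 (mulr_ge0 (ltW (tau_gt0 i.+1)) Ex)
    (mulr_ge0 (ltW (tau_gt0 i.+1)) (mulr_ge0 c0 xu)).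
  by congr (_ <= _); rewrite /M; field; rewrite gt_eqF.
have t00 : 0 <= (0 : R) <= 1 by rewrite lexx ler01.
(* [t = 0] gives monotonicity, which keeps every iterate in [K0], where [desc] applies. *)
have E_decr i : K0 (u i) -> (E (u i.+1) <= E (u i))%E.
  move=> uiK; apply: le_trans (desc i 0 uiK t00) _.
  by rewrite mul0r powR0 ?gt_eqF// mulr0 subr0 mulr0 subr0 -Efin.
have uK i : K0 (u i).
  elim: i => [//|i IH]; apply: le_trans (E_decr _ IH) _; exact: IH.
pose z i := e (u i) - e ustar.
have z_ge0 i : 0 <= z i.
  by rewrite subr_ge0 -lee_fin -!Efin//; exact: hustar.
have z_decr i : z i.+1 <= z i.
  by rewrite lerD2r -lee_fin -!Efin//; exact: E_decr.
have z_homo i j : (i <= j)%N -> z j <= z i.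
  by move=> /subnKC <-; elim: (j - i)%N => [|k IH];
    rewrite ?addn0// addnS (le_trans (z_decr _)).
have z0E : z 0%N = zeta0.
  by apply: EFin_inj; rewrite hzeta0 /z EFinB -!Efin.
rewrite (Efin _ (uK n)) (Efin _ K0us) -EFinB lee_fin -/(z n).

(* Recursion for the energy gap *)
pose L j := kappa omega q C0 K0 (tau j) * R0 `^ q.
have kappa_gt0 j : 0 < kappa omega q C0 K0 (tau j).
  rewrite divr_gt0 ?mulr_gt0 ?powR_gt0//.
  by have [] := hstable.1 _ (K_ext_bounded (tau j) K0bd) (K_ext_convex K0cv).
have L0 j : 0 < L j by rewrite mulr_gt0 ?powR_gt0.
have z_rec i : z i.+1 <= z i * (1 - (1 - q^-1) * (z i / L i.+1) `^ (q - 1)^-1).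
  have ziM : 0 <= z i <= M.
    by rewrite z_ge0 (le_trans _ hzeta0le)// -z0E z_homo.
  have [t01 tE] := optimal_step hq M0 ziM.
  set t := (z i / M) `^ _ in t01 tE.
  have := desc i t (uK i) t01; rewrite -/(z i) tE (Efin _ (uK _)) lee_fin => zi.
  apply: (@le_trans _ _ (z i - tau i.+1 * ((1 - q^-1) * (z i * t)))).
    by rewrite /z addrAC lerD2r.
  have -> : z i * (1 - (1 - q^-1) * (z i / L i.+1) `^ (q - 1)^-1) =
      z i - (1 - q^-1) * z i * (z i / L i.+1) `^ (q - 1)^-1 by ring.
  have -> : tau i.+1 * ((1 - q^-1) * (z i * t)) =
      (1 - q^-1) * z i * (tau i.+1 * t) by ring.
  rewrite lerD2l lerN2 ler_wpM2l//.
    by rewrite mulr_ge0// subr_ge0 invf_le1// ltW.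
  (* The step size is moved inside the power, so that only the bases need comparing. *)
  have -> : tau i.+1 * t = (tau i.+1 `^ (q - 1) * (z i / M)) `^ (q - 1)^-1.
    rewrite powRM ?powR_ge0 ?divr_ge0 ?(ltW M0)// -powRrM mulfV ?gt_eqF//.
    by rewrite powRr1// ltW.
  rewrite ge0_ler_powR ?nnegrE ?invr_ge0 ?(ltW p0)//.
  - by rewrite divr_ge0// ltW.
  - by rewrite mulr_ge0 ?powR_ge0// divr_ge0// ltW.
  (* After inversion and cancellation this is [C0 K0 <= C0 (K_ext K0 (tau i.+1))]. *)
  rewrite mulrCA ler_wpM2l// -[leRHS]invrK invf_div.
  rewrite lef_pV2 ?posrE ?divr_gt0 ?powR_gt0//.
  rewrite /M /L /kappa [leRHS]mulrAC ler_pM2r ?invr_gt0 ?powR_gt0//.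
  rewrite ler_pM2r ?powR_gt0// ler_pM2l//.
  rewrite ge0_ler_powR ?nnegrE ?(ltW q0) ?(ltW C0_gt0)//.
    by have [/ltW] := hstable.1 _ (K_ext_bounded (tau i.+1) K0bd)
      (K_ext_convex K0cv).
  apply: hstable.2 => //;
    [exact: K_ext_bounded|exact: K_ext_convex|exact: sub_K_ext].

(* Summation and the power mean *)
have nu_lt0 : nu < 0 by rewrite oppr_lt0 invr_gt0.
pose S := \sum_(1 <= j < n.+1) kappa omega q C0 K0 (tau j) `^ nu.
have S0 : 0 < S.
  rewrite /S big_nat_recr//= ltr_wpDl ?powR_gt0// sumr_ge0// => j _.
  exact: powR_ge0.
have nR : 0 < n%:R :> R by rewrite ltr0n.
have kbar_gt0 : 0 < kbar by rewrite powR_gt0// mulr_gt0 ?invr_gt0.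
have kbarE : kbar `^ nu = n%:R^-1 * S.
  by rewrite /kbar /power_mean -powRrM mulVf ?lt_eqF// powRr1//
    mulr_ge0 ?invr_ge0 ?ltW.
rewrite /bound -z0E; case: eqP => [z00|/eqP z00].
  by rewrite -z00 z_homo.
have z0_gt0 : 0 < z 0%N by rewrite lt_neqAle eq_sym z00 z_ge0.
(* The gap may vanish after finitely many steps; negative powers are then unusable, but the bound is
   nonnegative. *)
have [zn0|zn0] := leP (z n) 0.
  apply: le_trans zn0 _.
  by rewrite divr_ge0 ?powR_ge0// !mulr_ge0 ?powR_ge0// ltW.
have -> : - nu = (q - 1)^-1 by exact: opprK.
rewrite -(mulrA _ (R0 `^ q)); apply: powR_rate => //.
  exact: mulr_gt0 (powR_gt0 _ hR0) kbar_gt0.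
have := @powR_decrease_sum _ q L z n hq L0 _ z_rec.
(* The power mean is the constant that may replace every [kappa] without changing the sum of [nu]-th
   powers. *)
have -> : \sum_(1 <= j < n.+1) L j `^ (- (q - 1)^-1) =
    n%:R * (R0 `^ q * kbar) `^ (- (q - 1)^-1).
  rewrite (powRM _ (powR_ge0 _ _) (ltW kbar_gt0)) -/nu kbarE mulrCA.
  rewrite [n%:R * _]mulrA mulfV ?gt_eqF// mul1r mulr_sumr.
  by apply: eq_bigr => j _;
    rewrite /L powRM ?powR_ge0 ?(ltW (kappa_gt0 _))// mulrC.
(* The gaps are nonincreasing, so positivity at [n] gives it at all earlier indices. *)
by apply=> i ni; apply: lt_le_trans zn0 _; exact: z_homo.
Qed.
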